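(* Let $p$ be a prime, let $1\le t\le n<p$, let $r\ge 0$, and let $x_1,\dots,x_n\in GF(p)$ be public, pairwise distinct and nonzero. Then the modified Shamir secret sharing scheme with $r$ crucial shares (defined in the context) is ideal.
   Context: $GF(p)$ is the field with $p$ elements. Modified Shamir scheme with $r$ crucial shares: for a secret $S\in GF(p)$ the dealer draws $R_1,\dots,R_r,a_1,\dots,a_{t-1}$ independently and uniformly at random from $GF(p)$ (independently of $S$), sets $S'=S+\sum_{i=1}^r R_i$ and $f'(x)=S'+a_1x+\cdots+a_{t-1}x^{t-1}$ over $GF(p)$, and distributes the $n+r$ shares $S_i=f'(x_i)$ ($1\le i\le n$) and $R_1,\dots,R_r$ (the crucial shares), one share to each of $n+r$ shareholders. A set of shares ''can reconstruct $S$'' if there is a function of the values of these shares (and the public data) which returns $S$ for every secret and all possible values of the dealer's random choices. The access structure of the scheme is the family of all sets of shares that can reconstruct $S$. A secret sharing scheme is perfect if no set of shares outside its access structure allows learning anything about the secret: for every probability distribution of $S$ on $GF(p)$ and every set of shares not in the access structure, the joint value of these shares is statistically independent of $S$. A secret sharing scheme is ideal if it is perfect and each shareholder's share lies in the same domain as the secret (here $GF(p)$). *)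

(* Defs.v *)
(* MathComp world; [R : realType] supplies the real-valued probabilities.     *)
From mathcomp Require Import all_boot all_order all_algebra.
From mathcomp Require Import reals.

Set Implicit Arguments.
Unset Strict Implicit.
Unset Printing Implicit Defensive.

Import Order.TTheory GRing.Theory Num.Theory.
Local Open Scope ring_scope.

Record dist (R : realType) (T : finType) := Dist {
  dist_fun :> T -> R;
  dist_ge0 : forall x, 0 <= dist_fun x;
  dist_sum1 : \sum_x dist_fun x = 1 }.

Definition Pr (R : realType) (T : finType) (P : dist R T) (E : pred T) : R :=
  \sum_(x | E x) P x.

Definition independent (R : realType) (T : finType) (P : dist R T)
    (U V : finType) (X : T -> U) (Y : T -> V) : Prop :=
  forall u v, Pr P (fun z => (X z == u) && (Y z == v)) =
              Pr P (fun z => X z == u) * Pr P (fun z => Y z == v).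

Section Constructions.
Variable R : realType.

Lemma uniform_ge0 (T : finType) (x : T) : 0 <= (#|T|%:R^-1 : R).
Proof. by rewrite invr_ge0 ler0n. Qed.

Lemma uniform_sum1 (T : finType) (x0 : T) : \sum_(x : T) (#|T|%:R^-1 : R) = 1.
Proof.
have T0 : (#|T| > 0)%N by apply/card_gt0P; exists x0.
by rewrite sumr_const -[_ *+ _]mulr_natl divff // pnatr_eq0 -lt0n.
Qed.

Definition uniform (T : finType) (x0 : T) : dist R T :=
  Dist (@uniform_ge0 T) (uniform_sum1 x0).

Section Prod.
Variables (T U : finType) (P : dist R T) (Q : dist R U).

Lemma prod_dist_ge0 (z : T * U) : 0 <= P z.1 * Q z.2.
Proof. by rewrite mulr_ge0 ?dist_ge0. Qed.

Lemma prod_dist_sum1 : \sum_(z : T * U) P z.1 * Q z.2 = 1.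
Proof.
rewrite -(pair_bigA _ (fun x y => P x * Q y)) /= -[RHS](dist_sum1 P).
by apply: eq_bigr => x _; rewrite -mulr_sumr dist_sum1 mulr1.
Qed.

Definition prod_dist : dist R (T * U)%type :=
  Dist prod_dist_ge0 prod_dist_sum1.
End Prod.

Section IID.
Variables (I T : finType) (P : dist R T).

Lemma iid_ge0 (f : {ffun I -> T}) : 0 <= \prod_i P (f i).
Proof. by apply: prodr_ge0 => i _; apply: dist_ge0. Qed.

Lemma iid_sum1 : \sum_(f : {ffun I -> T}) \prod_i P (f i) = 1.
Proof.
rewrite -(bigA_distr_bigA (fun _ x => P x)) /=.
by rewrite big1 // => i _; apply: dist_sum1.
Qed.

Definition iid : dist R {ffun I -> T} := Dist iid_ge0 iid_sum1.
End IID.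
End Constructions.

(* [coins] is the space of values of the dealer's random choices, drawn from  *)
(* [coins_law]; public data are fixed once the scheme is.                     *)
Record scheme (R : realType) := Scheme {
  secret : finType;
  holder : finType;
  share_dom : holder -> finType;
  coins : finType;
  coins_law : dist R coins;
  share : secret -> coins -> forall i : holder, share_dom i }.

Section SchemeProperties.
Variables (R : realType) (Sch : scheme R).

Definition joint_value (A : {set holder Sch}) : finType :=
  {dffun forall i : {i : holder Sch | i \in A}, share_dom (val i)}.

Definition joint_shares (A : {set holder Sch})
    (s : secret Sch) (w : coins Sch) : joint_value A :=
  [ffun i : {i : holder Sch | i \in A} => share s w (val i)].

Definition can_reconstruct (A : {set holder Sch}) : Prop :=
  exists rec : joint_value A -> secret Sch,
    forall s w, rec (joint_shares A s w) = s.

Definition access_structure : {set holder Sch} -> Prop := can_reconstruct.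

(* Taking the product with [coins_law] makes the coins independent of S. *)
Definition perfect : Prop :=
  forall (P : dist R (secret Sch)) (A : {set holder Sch}),
    ~ access_structure A ->
    independent (prod_dist P (coins_law Sch))
      (fun z => joint_shares A z.1 z.2) (fun z => z.1).

Definition ideal : Prop :=
  perfect /\ forall i : holder Sch, share_dom i = secret Sch.
End SchemeProperties.

Section ModifiedShamir.
Variables (R : realType) (p n t r : nat) (x : 'I_n -> 'F_p).

(* [a j] is the coefficient of degree [j.+1]. *)
Definition shamir_poly (S' : 'F_p) (a : {ffun 'I_t.-1 -> 'F_p}) : {poly 'F_p} :=
  S'%:P + \sum_(j < t.-1) a j *: 'X^(j.+1).

(* The coins are the pair (crucial shares, non-constant coefficients). *)
Definition shamir_share (S : 'F_p)
    (w : {ffun 'I_r -> 'F_p} * {ffun 'I_t.-1 -> 'F_p})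
    (i : 'I_n + 'I_r) : 'F_p :=
  match i with
  | inl k => (shamir_poly (S + \sum_(j < r) w.1 j) w.2).[x k]
  | inr k => w.1 k
  end.

Definition modified_shamir : scheme R :=
  @Scheme R 'F_p ('I_n + 'I_r)%type (fun=> 'F_p)
    ({ffun 'I_r -> 'F_p} * {ffun 'I_t.-1 -> 'F_p})%type
    (prod_dist (iid 'I_r (uniform R (0 : 'F_p)))
               (iid 'I_t.-1 (uniform R (0 : 'F_p))))
    shamir_share.
End ModifiedShamir.

Arguments modified_shamir R {p n} t r x.

(* Main.v *)
(** The share map is linear in the pair (secret, coins). If a set of shares
does not determine the secret, two pairs with different secrets agree on it;
multiples of their difference turn any secret into any other without changing
these shares. The resulting translation of the coins preserves their uniform
law, so the law of the shares given the secret does not depend on the secret.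
In particular no description of the access structure is needed. *)
Require Import Defs.
From mathcomp Require Import all_boot all_order all_algebra.
From mathcomp Require Import reals.
From mathcomp Require Import ring.

Import Order.TTheory GRing.Theory Num.Theory.
Local Open Scope ring_scope.

Lemma Pr_prod_dist (R : realType) (T U : finType) (P : dist R T)
    (Q : dist R U) (E : pred (T * U)) :
  Pr (prod_dist P Q) E = \sum_s P s * Pr Q (fun w => E (s, w)).
Proof.
rewrite /Pr; under [RHS]eq_bigr => s _ do rewrite mulr_sumr big_mkcond.
by rewrite pair_bigA big_mkcond; apply: eq_bigr => -[s w].
Qed.

(** The law of [X s] under [Q] is the conditional law given the secret [s]; if it is the same for
    all [s], averaging it over [P] gives the same law again. *)
Lemma independent_fst (R : realType) (T U V : finType) (P : dist R T)
    (Q : dist R U) (X : T -> U -> V) :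
  (forall s s' v, Pr Q (fun w => X s w == v) = Pr Q (fun w => X s' w == v)) ->
  independent (prod_dist P Q) (fun z => X z.1 z.2) (fun z => z.1).
Proof.
move=> X_inv v s.
have PrQT : Pr Q predT = 1 := dist_sum1 Q.
have PrQ0 (E : pred U) : E =1 pred0 -> Pr Q E = 0.
  by move=> E0; rewrite /Pr big_pred0.
(* Serves twice: with [X s w == v] for the joint law, and with [predT] for the marginal law of the
   secret. *)
have pick_s (E : T -> pred U) : Pr (prod_dist P Q)
    (fun z => E z.1 z.2 && (z.1 == s)) = P s * Pr Q (E s).
  rewrite Pr_prod_dist (bigD1 s) //= big1 ?addr0.
    by congr (_ * _); apply: eq_bigl => w; rewrite eqxx andbT.
  by move=> s' /negbTE s's; rewrite PrQ0 ?mulr0 // => w; rewrite /= s's andbF.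
rewrite (pick_s (fun s w => X s w == v)) (pick_s (fun _ => predT)) PrQT mulr1.
rewrite Pr_prod_dist mulrC; congr (_ * _).
under eq_bigr => s' _ do rewrite (X_inv s' s).
by rewrite -mulr_suml dist_sum1 mul1r.
Qed.

(** An injective self-map of a finite type is a permutation, and a uniform law is invariant under
    permutations. *)
Lemma Pr_const_inj (R : realType) (T : finType) (Q : dist R T) (g : T -> T)
    (E : pred T) :
  (forall w w', Q w = Q w') -> injective g -> Pr Q (E \o g) = Pr Q E.
Proof.
move=> Qc g_inj; rewrite /Pr [RHS](reindex_inj g_inj) /=.
by apply: eq_bigr.
Qed.

Lemma horner_shamir_poly (p t : nat) (S y : 'F_p) (a : {ffun 'I_t.-1 -> 'F_p}) :
  (shamir_poly S a).[y] = S + \sum_(j < t.-1) a j * y ^+ j.+1.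
Proof.
rewrite /shamir_poly hornerD hornerC horner_sum.
by under eq_bigr do rewrite hornerZ hornerXn.
Qed.

Lemma shamir_share_linear (p n t r : nat) (x : 'I_n -> 'F_p) (c S S1 S2 : 'F_p)
    (w w1 w2 : {ffun 'I_r -> 'F_p} * {ffun 'I_t.-1 -> 'F_p}) (i : 'I_n + 'I_r) :
  shamir_share x (S + c * (S1 - S2))
    (w + ([ffun j => c * (w1.1 j - w2.1 j)], [ffun j => c * (w1.2 j - w2.2 j)]))
    i =
  shamir_share x S w i + c * (shamir_share x S1 w1 i - shamir_share x S2 w2 i).
Proof.
case: i => k /=; last by rewrite !ffunE.
rewrite !horner_shamir_poly.
under eq_bigr do rewrite !ffunE.
under [X in _ + X]eq_bigr do rewrite !ffunE mulrDl -mulrA mulrBl.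
by rewrite !big_split /= -!mulr_sumr !sumrB; ring.
Qed.

(* [s0] is needed: with an empty secret type and inhabited shares no
   reconstruction function exists. *)
Lemma not_can_reconstruct (R : realType) (Sch : scheme R)
    (s0 : secret Sch) (A : {set holder Sch}) :
  ~ can_reconstruct A ->
  exists s1 w1 s2 w2, s1 != s2 /\ joint_shares A s1 w1 = joint_shares A s2 w2.
Proof.
move=> nrec.
case: (boolP [exists z1 : secret Sch * coins Sch, exists z2,
    (z1.1 != z2.1) && (joint_shares A z1.1 z1.2 == joint_shares A z2.1 z2.2)]).
  case/existsP=> -[s1 w1] /existsP[[s2 w2]] /andP[/= ? /eqP ?].
  by exists s1, w1, s2, w2.
move=> /existsPn det; case: nrec.
(* Reconstruction by search: take any pair compatible with the shares; [det] forces all such pairs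
   to have the same secret. The default [s0] is only returned on unattainable values [v]. *)
exists (fun v => odflt s0 (omap fst
  [pick z : secret Sch * coins Sch | joint_shares A z.1 z.2 == v])) => s w.
case: pickP => [z /= zs|/(_ (s, w)) /=]; last by rewrite eqxx.
apply/eqP; have /existsPn/(_ (s, w)) := det z.
by rewrite /= zs andbT negbK.
Qed.

Lemma perfect_modified_shamir (R : realType) (p n t r : nat)
    (x : 'I_n -> 'F_p) : perfect (modified_shamir R t r x).
Proof.
move=> P A /(@not_can_reconstruct _ (modified_shamir R t r x) (0 : 'F_p))[s1 [w1 [s2 [w2 [s12 eqA]]]]].
apply: independent_fst => s s' v.
(* The multiple of the collision [s1 - s2] that moves the secret exactly from [s] to [s']; [d] is
   the matching shift of the coins. *)
pose c : 'F_p := (s' - s) / (s1 - s2).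
pose d : coins (modified_shamir R t r x) :=
  ([ffun j => c * (w1.1 j - w2.1 j)], [ffun j => c * (w1.2 j - w2.2 j)]).
have s'E : s' = s + c * (s1 - s2).
  by rewrite /c divfK ?subr_eq0 // addrC subrK.
have shift w : joint_shares A s' (w + d) = joint_shares A s w.
  apply/ffunP=> i; rewrite !ffunE /= s'E shamir_share_linear.
  by move/ffunP/(_ i): eqA; rewrite !ffunE /= => ->; rewrite subrr mulr0 addr0.
(* [erefl]: the coin law is convertible to a constant function. *)
rewrite -[RHS](Pr_const_inj _ _ (coins_law (modified_shamir R t r x))
  (fun w => w + d) _ (fun _ _ => erefl) (addIr d)).
by apply: eq_bigl => w /=; rewrite shift.
Qed.

Theorem lemma5 (R : realType) (p n t r : nat) (x : 'I_n -> 'F_p)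
  (p_prime : prime p) (t_ge1 : (1 <= t)%N) (t_le_n : (t <= n)%N)
  (n_lt_p : (n < p)%N) (x_inj : injective x) (x_neq0 : forall i, x i != 0) :
  ideal (modified_shamir R t r x).
Proof. by split=> //; apply: perfect_modified_shamir. Qed.
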